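(* Let $\mathcal{G}=(\mathcal{V},\mathcal{E},\mathbf{W})$ be a connected signed weighted undirected graph with Laplacian $L$. If $L$ is positive semi-definite with only one zero eigenvalue, then $$0<r_{\mathrm{eff}}(L,\mathcal{V}_a,\mathcal{V}_b)\le r_{\mathrm{eff}}(L,\mathcal{V}_a^*,\mathcal{V}_b^* )\quad\text{and}\quad g_{\mathrm{eff}}(L,\mathcal{V}_a,\mathcal{V}_b)\ge g_{\mathrm{eff}}(L,\mathcal{V}_a^*,\mathcal{V}_b^* )>0$$ for any non-empty sets $\mathcal{V}_a,\mathcal{V}_b,\mathcal{V}_a^*,\mathcal{V}_b^*$ such that $\mathcal{V}_a,\mathcal{V}_b\subset\mathcal{V}$, $\mathcal{V}_a\cap\mathcal{V}_b=\emptyset$, $\mathcal{V}_a^*\subseteq\mathcal{V}_a$ and $\mathcal{V}_b^*\subseteq\mathcal{V}_b$.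
   Context: Graph: $\mathcal{G}=(\mathcal{V},\mathcal{E},\mathbf{W})$ is a simple undirected connected graph with finite node set $\mathcal{V}$, $n=|\mathcal{V}|$, edge set $\mathcal{E}$, $l=|\mathcal{E}|$; each edge $(i,j)$ carries a nonzero real weight $w_{ij}$, positive or negative, and $\mathbf{W}\in\mathbb{R}^{l\times l}$ is the diagonal matrix of edge weights. With the edges arbitrarily oriented, $\mathbf{E}\in\mathbb{R}^{n\times l}$ is the incidence matrix (column of an edge from $i$ to $j$: entry $1$ in row $i$, $-1$ in row $j$, $0$ elsewhere). The Laplacian is $L=\mathbf{E}\mathbf{W}\mathbf{E}^T$ (real symmetric with zero row sums). ''Positive semi-definite with only one zero eigenvalue'' means $L\succeq 0$ and $0$ is a simple eigenvalue. Effective resistance/conductance: for non-empty disjoint $\mathcal{V}_a,\mathcal{V}_b\subset\mathcal{V}$ put $\mathcal{V}_c=\mathcal{V}\setminus(\mathcal{V}_a\cup\mathcal{V}_b)$, $a=|\mathcal{V}_a|$, $b=|\mathcal{V}_b|$, and let $L_{xy}$ be the submatrix of $L$ with rows indexed by $\mathcal{V}_x$ and columns by $\mathcal{V}_y$. When $L_{cc}$ is nonsingular (which is automatic if $L$ is positive semi-definite with only one zero eigenvalue), let $L/L_{cc}$ be the Schur complement $$L/L_{cc}=\begin{bmatrix}L_{aa}&L_{ab}\\L_{ab}^T&L_{bb}\end{bmatrix}-\begin{bmatrix}L_{ac}\\L_{bc}\end{bmatrix}L_{cc}^{-1}\begin{bmatrix}L_{ac}^T&L_{bc}^T\end{bmatrix},$$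 with $L/L_{cc}=L$ if $\mathcal{V}_c=\emptyset$. Then $g_{\mathrm{eff}}(L,\mathcal{V}_a,\mathcal{V}_b)=\mathbf{e}_{\mathcal{V}_a}^T(L/L_{cc})\mathbf{e}_{\mathcal{V}_a}$, where $\mathbf{e}_{\mathcal{V}_a}\in\mathbb{R}^{a+b}$ has entries $1$ on $\mathcal{V}_a$ and $0$ on $\mathcal{V}_b$, and $r_{\mathrm{eff}}(L,\mathcal{V}_a,\mathcal{V}_b)=g_{\mathrm{eff}}(L,\mathcal{V}_a,\mathcal{V}_b)^{-1}$ (with $r_{\mathrm{eff}}=\infty$ if $g_{\mathrm{eff}}=0$). *)

(* Defs.v *)
From HB Require Import structures.
From mathcomp Require Import all_boot all_order all_algebra.
From mathcomp Require Import reals constructive_ereal.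

Set Implicit Arguments.
Unset Strict Implicit.
Unset Printing Implicit Defensive.

Import Order.TTheory GRing.Theory Num.Theory.
Local Open Scope ring_scope.

(* An edge between i and j is the two-element set [set i; j]: no loops, no
   multiple edges.  Only the values of weight on edge_set are meaningful. *)
Record signed_graph (R : realType) (V : finType) := SignedGraph {
  edge_set : {set {set V}};
  card_edge : forall e, e \in edge_set -> #|e| = 2%N;
  weight : {set V} -> R;
  weight_neq0 : forall e, e \in edge_set -> weight e != 0
}.

Definition adjacent (R : realType) (V : finType) (G : signed_graph R V) :
  rel V := fun i j => [set i; j] \in edge_set G.

Definition connected_graph (R : realType) (V : finType)
  (G : signed_graph R V) : Prop := forall i j : V, connect (adjacent G) i j.

Record orientation (R : realType) (V : finType) (G : signed_graph R V) :=
  Orientation {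
    edge_tail : {set V} -> V;
    edge_head : {set V} -> V;
    orientation_edge :
      forall e, e \in edge_set G -> e = [set edge_tail e; edge_head e]
  }.

(* Matrix rows are indexed by 'I_#|V| and edge columns by 'I_#|edge_set G|,
   each identified with its elements through enum_val. *)
Definition incidence_mx (R : realType) (V : finType) (G : signed_graph R V)
    (o : orientation G) : 'M[R]_(#|V|, #|edge_set G|) :=
  \matrix_(i, k)
    if enum_val i == edge_tail o (enum_val k) then 1
    else if enum_val i == edge_head o (enum_val k) then -1
    else 0.

Definition weight_mx (R : realType) (V : finType) (G : signed_graph R V) :
    'M[R]_#|edge_set G| :=
  diag_mx (\row_k weight G (enum_val k)).

Definition laplacian (R : realType) (V : finType) (G : signed_graph R V)
    (o : orientation G) : 'M[R]_#|V| :=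
  incidence_mx o *m weight_mx G *m (incidence_mx o)^T.

Definition psd (R : realType) (n : nat) (A : 'M[R]_n) : Prop :=
  A^T = A /\ forall x : 'cV[R]_n, 0 <= (x^T *m A *m x) 0 0.

(* algebraic multiplicity one *)
Definition simple_eigenvalue (R : realType) (n : nat) (A : 'M[R]_n) (a : R) :
  Prop := mup a (char_poly A) = 1%N.

Definition submatrix (R : realType) (V : finType) (L : 'M[R]_#|V|)
    (X Y : {set V}) : 'M[R]_(#|X|, #|Y|) :=
  mxsub (fun i : 'I_#|X| => enum_rank (enum_val i))
        (fun j : 'I_#|Y| => enum_rank (enum_val j)) L.

(* L/L_cc.  If Vc is empty the subtracted product has inner dimension 0, hence
   vanishes.  As invmx is total, this is the Schur complement only when L_cc
   is nonsingular. *)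
Definition schur_complement (R : realType) (V : finType) (L : 'M[R]_#|V|)
    (Va Vb : {set V}) : 'M[R]_(#|Va| + #|Vb|) :=
  let Vc := ~: (Va :|: Vb) in
  block_mx (submatrix L Va Va) (submatrix L Va Vb)
           (submatrix L Va Vb)^T (submatrix L Vb Vb)
  - col_mx (submatrix L Va Vc) (submatrix L Vb Vc)
    *m invmx (submatrix L Vc Vc)
    *m row_mx (submatrix L Va Vc)^T (submatrix L Vb Vc)^T.

Definition indicator_a (R : realType) (V : finType) (Va Vb : {set V}) :
    'cV[R]_(#|Va| + #|Vb|) :=
  col_mx (const_mx 1) (const_mx 0).

Definition geff (R : realType) (V : finType) (L : 'M[R]_#|V|)
    (Va Vb : {set V}) : R :=
  ((indicator_a R Va Vb)^T *m schur_complement L Va Vb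
     *m indicator_a R Va Vb) 0 0.

(* In \bar R the inverse of 0 is +oo. *)
Definition reff (R : realType) (V : finType) (L : 'M[R]_#|V|)
    (Va Vb : {set V}) : \bar R := ((geff L Va Vb)%:E)^-1%E.

(* Main.v *)
Require Import Defs.
From mathcomp Require Import all_boot all_order all_algebra.
From mathcomp Require Import reals constructive_ereal.
From mathcomp Require Import ring lra.
Import Order.TTheory GRing.Theory Num.Theory.
Local Open Scope ring_scope.

Set Implicit Arguments.
Unset Strict Implicit.
Unset Printing Implicit Defensive.

(** The effective conductance obeys a Dirichlet principle: [geff L Va Vb] is
    the least energy [x^T L x] of a vector of node potentials [x] equal to 1 on
    [Va] and 0 on [Vb], and this minimum is attained ([geff_variational]).
    Shrinking [Va] and [Vb] enlarges the set of admissible potentials, so it can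
    only lower the minimum; this is the monotonicity of [geff], and that of
    [reff] follows by inverting.  The minimum is positive because an admissible
    potential takes both values 0 and 1, while only constant potentials have
    zero energy.

    With signed weights the last fact is not visible on the graph: it comes from
    the two spectral hypotheses.  For a positive semi-definite matrix, zero
    energy means membership in the kernel ([psd_quad_eq0]); the kernel contains
    the all-ones vector ([laplacian_col_sum]); and it is a line, since its
    dimension is at most the algebraic multiplicity of the eigenvalue 0
    ([corank_dvd_char_poly]).

    The Dirichlet principle itself is completion of the square.  Once the nodes
    are listed in the order [Va], [Vb], the rest, and the potential on the rest
    is called [z], the energy is [geff] plus the quadratic form of [L_cc] at a
    translate of [z] ([quad_block]); this form is nonnegative and the translate
    can be made 0. *)

(** * Energy and its kernel *)

Definition quad (R : realType) (n : nat) (A : 'M[R]_n) (x : 'cV[R]_n) : R :=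
  (x^T *m A *m x) 0 0.

(** Stated through the energy rather than through [A *m x = 0] because this form
    passes to a simultaneous reordering of rows and columns by [quad_mxsub]
    alone. *)
Definition constant_kernel (R : realType) (n : nat) (A : 'M[R]_n) : Prop :=
  forall x : 'cV[R]_n, quad A x = 0 -> forall i j, x i 0 = x j 0.

(** Geometric multiplicity is at most algebraic multiplicity, for the
    eigenvalue 0.  Gaussian elimination gives [A = C P E] with [C], [E]
    invertible and [P] the partial identity of rank [r], so that
    [X - A = C (X C^-1 E^-1 - P) E]; in the middle factor each row of index at
    least [r] is a multiple of [X], and the determinant is multilinear. *)
Lemma corank_dvd_char_poly (F : fieldType) (n : nat) (A : 'M[F]_n) :
  'X^(n - \rank A) %| char_poly A.
Proof.
set r := \rank A.
pose liftP (M : 'M[F]_n) : 'M[{poly F}]_n := map_mx polyC M.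
pose C := col_ebase A; pose E := row_ebase A.
pose D := invmx C *m invmx E.
pose d : 'rV[{poly F}]_n := \row_i (if (i < r)%N then 1 else 'X).
pose N : 'M[{poly F}]_n := \matrix_(i, j)
  (if (i < r)%N then 'X * (D i j)%:P - ((pid_mx r : 'M[F]_n) i j)%:P
   else (D i j)%:P).
(* [d] extracts the factor [X] from the rows below the rank, leaving [N]. *)
have dNE : diag_mx d *m N = 'X *: liftP D - liftP (pid_mx r).
  apply/matrixP => i j; rewrite mul_diag_mx !mxE.
  case: ifP => lt_ir; rewrite ?mul1r ?andbF //=.
  by rewrite subr0.
have charE : char_poly_mx A = liftP C *m (diag_mx d *m N) *m liftP E.
  rewrite dNE mulmxBr mulmxBl /char_poly_mx -!map_mxM /= mulmx_ebase.
  congr (_ - _); rewrite -scalemxAr -scalemxAl -!map_mxM /D /=.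
  rewrite mulmxA mulmxV ?col_ebase_unit // mul1mx mulVmx ?row_ebase_unit //.
  by rewrite map_mx1 scalemx1.
rewrite /char_poly charE !det_mulmx det_diag.
suff -> : \prod_i d 0 i = 'X^(n - r).
  by rewrite dvdp_mulr // dvdp_mull // dvdp_mulr.
under eq_bigr do rewrite mxE.
(* Below index [r] the product is 1; the n - r remaining factors are [X]. *)
rewrite -(big_mkord predT (fun i => if (i < r)%N then 1 else 'X)) /=.
rewrite (big_cat_nat (n := r)) ?rank_leq_row //=.
rewrite big_nat big1 ?mul1r => [|i /andP[_ ->] //].
rewrite big_nat (eq_bigr (fun=> 'X)) => [|i /andP[le_ri _]]; last first.
  by rewrite ltnNge le_ri.
by rewrite -big_nat prodr_const_nat.
Qed.

Lemma kernel_simple_eigenvalue0 (R : realType) (n : nat) (A : 'M[R]_n)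
    (u v : 'rV[R]_n) :
  simple_eigenvalue A 0 -> u != 0 -> u *m A = 0 -> v *m A = 0 ->
  exists c : R, v = c *: u.
Proof.
move=> simple0 nz_u uA0 vA0; apply/sub_rVP.
have corank_le1 : (n - \rank A <= 1)%N.
  rewrite -[X in (_ <= X)%N]simple0 mup_geq ?monic_neq0 ?char_poly_monic //.
  by rewrite subr0 corank_dvd_char_poly.
have sub_u : (u <= kermx A)%MS by apply/sub_kermxP.
have/eqmxP/eqmx_sym eq_u : (u == kermx A)%MS.
  rewrite -(geq_leqif (mxrank_leqif_eq sub_u)) mxrank_ker.
  by rewrite rank_rV nz_u.
by rewrite -eq_u; apply/sub_kermxP.
Qed.

(** A point of zero energy is a minimum of the form, so its gradient there
    vanishes.  Concretely, moving from [x] by [- s] times [y = A x] changes the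
    energy by [- 2 s |y|^2 + s^2 (y^T A y)], which is negative for small
    positive [s] unless [y = 0]. *)
Lemma psd_quad_eq0 (R : realType) (n : nat) (A : 'M[R]_n) (x : 'cV[R]_n) :
  psd A -> quad A x = 0 -> A *m x = 0.
Proof.
move=> [symA posA] qx0; set y := A *m x.
pose p := (y^T *m y) 0 0; pose w := quad A y.
have pE : p = \sum_i (y i 0) ^+ 2.
  by rewrite /p mxE; apply: eq_bigr => i _; rewrite mxE -expr2.
have w_ge0 : 0 <= w by apply: posA.
have expand s : quad A (x - s *: y) = - (2 * s * p) + s ^+ 2 * w.
  have xA : x^T *m A = y^T by rewrite trmx_mul symA.
  have -> : quad A (x - s *: y) = quad A x - s * p - s * p + s ^+ 2 * w.
    rewrite /quad.
    have -> : (x - s *: y)^T = x^T - s *: y^T by rewrite linearB linearZ.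
    rewrite mulmxBl xA !mulmxBr !mulmxBl.
    rewrite -!scalemxAl -!scalemxAr -(mulmxA _ A x) -/y /p /w /quad.
    move: (y^T *m x) (y^T *m y) (y^T *m A *m y) => a b c.
    rewrite !mxE; ring.
  rewrite qx0; ring.
have p_ge0 : 0 <= p by rewrite pE sumr_ge0 // => i _; rewrite sqr_ge0.
have p0 : p = 0.
  apply/eqP; rewrite eq_le p_ge0 andbT leNgt; apply/negP => p_gt0.
  have w1_gt0 : 0 < w + 1 by lra.
  (* The step p / w would do if w were nonzero; w + 1 is always positive. *)
  have := posA (x - (p / (w + 1)) *: y); rewrite -/(quad _ _) expand.
  have -> : - (2 * (p / (w + 1)) * p) + (p / (w + 1)) ^+ 2 * w
            = - ((p / (w + 1)) ^+ 2 * (w + 2)).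
    by field; rewrite gt_eqF.
  by rewrite oppr_ge0 leNgt mulr_gt0 ?exprn_gt0 ?divr_gt0 //; lra.
apply/matrixP => i j; rewrite ord1 [RHS]mxE.
rewrite pE in p0.
apply/eqP; rewrite -sqrf_eq0; apply/eqP.
by apply: (psumr_eq0P _ p0) => // k _; apply: sqr_ge0.
Qed.

Lemma laplacian_col_sum (R : realType) (V : finType) (G : signed_graph R V)
    (o : orientation G) :
  (const_mx 1 : 'rV[R]_#|V|) *m laplacian o = 0.
Proof.
suff inc0 : (const_mx 1 : 'rV[R]_#|V|) *m incidence_mx o = 0.
  by rewrite /laplacian !mulmxA inc0 !mul0mx.
apply/matrixP => i k; rewrite !mxE.
set t := edge_tail o (enum_val k); set h := edge_head o (enum_val k).
(* Since edges have two distinct endpoints, each column of the incidence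
   matrix really contains both a 1 and a -1. *)
have neq_ht : h != t.
  have ek := enum_valP k; have := card_edge ek.
  rewrite (orientation_edge o ek) -/t -/h cards2 eq_sym.
  by case: (h != t).
rewrite (reindex enum_rank) /=; last exact: onW_bij (enum_rank_bij V).
under eq_bigr do rewrite !mxE mul1r enum_rankK -/t -/h.
rewrite (bigD1 t) //= eqxx (bigD1 h) //= (negPf neq_ht) eqxx big1.
  by rewrite addr0 subrr.
by move=> v /andP[/negPf -> /negPf ->].
Qed.

Lemma laplacian_constant_kernel (R : realType) (V : finType)
    (G : signed_graph R V) (o : orientation G) :
  psd (laplacian o) -> simple_eigenvalue (laplacian o) 0 ->
  constant_kernel (laplacian o).
Proof.
move=> psdL simple0 x qx0 i j.
have xL : x^T *m laplacian o = 0.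
  by rewrite -[laplacian o](proj1 psdL) -trmx_mul (psd_quad_eq0 psdL qx0) trmx0.
have nz1 : (const_mx 1 : 'rV[R]_#|V|) != 0.
  by apply/eqP => /matrixP/(_ 0 i)/eqP; rewrite !mxE oner_eq0.
have [c /matrixP xE] :=
  kernel_simple_eigenvalue0 simple0 nz1 (laplacian_col_sum o) xL.
by have := xE 0 i; have := xE 0 j; rewrite !mxE => -> ->.
Qed.

(** * Schur complements by completing the square *)

Lemma quad_block (R : realType) (m k : nat) (M : 'M[R]_m) (B : 'M[R]_(m, k))
    (C : 'M[R]_k) (y : 'cV[R]_m) (z : 'cV[R]_k) :
  C^T = C -> C \in unitmx ->
  quad (block_mx M B B^T C) (col_mx y z) =
  quad (M - B *m invmx C *m B^T) y + quad C (z + invmx C *m B^T *m y).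
Proof.
move=> symC unitC; rewrite /quad.
have symV : (invmx C)^T = invmx C by rewrite trmx_inv symC.
have trS : (z + invmx C *m B^T *m y)^T = z^T + y^T *m B *m invmx C.
  by rewrite linearD /= !trmx_mul trmxK symV mulmxA.
rewrite tr_col_mx mul_row_block mul_row_col trS.
rewrite !(mulmxDl, mulmxDr, mulmxBl, mulmxBr) !mulmxA mulmxKV //.
rewrite -(mulmxA z^T C (invmx C)) mulmxV // mulmx1.
rewrite mulmxN mulNmx !mulmxA.
move: (y^T *m M *m y) (z^T *m B^T *m y) (y^T *m B *m z) (z^T *m C *m z)
  (y^T *m B *m invmx C *m B^T *m y) => q1 q2 q3 q4 q5.
rewrite !mxE; ring.
Qed.

(** A kernel vector of the corner [C], extended by 0, has zero energy for the
    whole matrix; it is then constant, hence 0 because at least one coordinate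
    lies outside the corner. *)
Lemma constant_kernel_unitmx (R : realType) (m k : nat) (M : 'M[R]_m)
    (B : 'M[R]_(m, k)) (C : 'M[R]_k) :
  (0 < m)%N -> constant_kernel (block_mx M B B^T C) -> C \in unitmx.
Proof.
move=> m_gt0 ck; rewrite -row_free_unit; apply: inj_row_free => v vC0.
have q0 : quad (block_mx M B B^T C) (col_mx 0 v^T) = 0.
  rewrite /quad tr_col_mx trmxK trmx0 mul_row_block mul_row_col.
  by rewrite vC0 !mul0mx mulmx0 !add0r mul0mx mxE.
apply/matrixP => i j; rewrite ord1.
have := ck _ q0 (rshift m j) (lshift k (Ordinal m_gt0)).
by rewrite col_mxEd col_mxEu !mxE.
Qed.

Lemma quad_mxsub (R : realType) (m n : nat) (f : 'I_m -> 'I_n)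
    (A : 'M[R]_n) (x : 'cV[R]_n) :
  bijective f -> quad (mxsub f f A) (rowsub f x) = quad A x.
Proof.
move=> bij_f; rewrite /quad !mxE (reindex f) /=; last exact: onW_bij.
apply: eq_bigr => j _; rewrite !mxE (reindex f) /=; last exact: onW_bij.
by congr (_ * _); apply: eq_bigr => i _; rewrite !mxE.
Qed.

(** * Listing the nodes as Va, Vb and the rest *)

(** The reordering of the nodes that is implicit in [schur_complement]: a
    position in the concatenation of [Va], [Vb] and their complement is sent to
    the row of [L] of the node listed there. *)
Definition layout (V : finType) (Va Vb : {set V})
    (i : 'I_(#|Va| + #|Vb| + #|~: (Va :|: Vb)|)) : 'I_#|V| :=
  enum_rank match split i with
  | inl j => match split j with
             | inl p => enum_val p
             | inr p => enum_val p
             end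
  | inr p => enum_val p
  end.

Lemma layout_bij (V : finType) (Va Vb : {set V}) :
  Va :&: Vb = set0 -> bijective (@layout V Va Vb).
Proof.
move=> disj.
have notin v : v \in Va -> v \in Vb -> False.
  by move=> va vb; have := in_set0 v; rewrite -disj inE va vb.
apply: inj_card_bij; last first.
  by rewrite !card_ord -(cardsC (Va :|: Vb)) cardsU disj cards0 subn0.
move=> i j /enum_rank_inj; rewrite -[i]splitK -[j]splitK !unsplitK.
have c_ab (p : 'I_#|~: (Va :|: Vb)|) v :
    v = enum_val p -> (v \in Va) || (v \in Vb) -> False.
  by move=> -> vab; have := enum_valP p; rewrite inE in_setU vab.
case: (split i) => [i1|i1]; case: (split j) => [j1|j1] /=.
- rewrite -[i1]splitK -[j1]splitK !unsplitK.
  case: (split i1) => [p|p]; case: (split j1) => [q|q] /= eq_pq.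
  + by rewrite (enum_val_inj eq_pq).
  + by case: (notin (enum_val p)); [|rewrite eq_pq]; apply: enum_valP.
  + by case: (notin (enum_val p)); [rewrite eq_pq|]; apply: enum_valP.
  + by rewrite (enum_val_inj eq_pq).
- by case: (split i1) => p /c_ab[]; rewrite (enum_valP p) ?orbT.
- by case: (split j1) => p /esym/c_ab[]; rewrite (enum_valP p) ?orbT.
- by move=> /enum_val_inj ->.
Qed.

Lemma mxsub_layout (R : realType) (V : finType) (L : 'M[R]_#|V|)
    (Va Vb : {set V}) (Vc := ~: (Va :|: Vb)) :
  L^T = L ->
  mxsub (@layout V Va Vb) (@layout V Va Vb) L =
  block_mx
    (block_mx (submatrix L Va Va) (submatrix L Va Vb)
              (submatrix L Va Vb)^T (submatrix L Vb Vb))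
    (col_mx (submatrix L Va Vc) (submatrix L Vb Vc))
    (col_mx (submatrix L Va Vc) (submatrix L Vb Vc))^T
    (submatrix L Vc Vc).
Proof.
move=> symL.
have sym i j : L i j = L j i by rewrite -[in LHS]symL mxE.
apply/matrixP => i j; rewrite !mxE /layout.
case: (split i) => [i1|p]; rewrite !mxE;
  case: (split j) => [j1|q]; rewrite !mxE.
- case: (split i1) => p; rewrite !mxE; case: (split j1) => q; rewrite !mxE //.
- by case: (split i1) => p; rewrite !mxE.
- by case: (split j1) => q; rewrite !mxE.
- by [].
Qed.

Lemma split_lshift (m n : nat) (i : 'I_m) : split (lshift n i) = inl i.
Proof. exact: unsplitK (inl i). Qed.

Lemma split_rshift (m n : nat) (i : 'I_n) : split (rshift m i) = inr i.
Proof. exact: unsplitK (inr i). Qed.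

(** * The Dirichlet principle *)

Definition potential (R : realType) (V : finType) (Va Vb : {set V})
    (x : 'cV[R]_#|V|) : Prop :=
  (forall v, v \in Va -> x (enum_rank v) 0 = 1) /\
  (forall v, v \in Vb -> x (enum_rank v) 0 = 0).

(** In the listing [Va], [Vb], rest, an admissible potential is the vector
    [indicator_a] followed by arbitrary values [z] on the remaining nodes. *)
Lemma potentialP (R : realType) (V : finType) (Va Vb : {set V})
    (x : 'cV[R]_#|V|) :
  potential Va Vb x <->
  exists z, rowsub (@layout V Va Vb) x = col_mx (indicator_a R Va Vb) z.
Proof.
split=> [[xa xb]|[z xz]].
  exists (dsubmx (rowsub (@layout V Va Vb) x)); rewrite -[LHS]vsubmxK.
  congr col_mx; apply/matrixP => i j; rewrite !mxE ord1 /layout.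
  rewrite split_lshift.
  by case: (split i) => p; rewrite mxE; [apply: xa|apply: xb]; apply: enum_valP.
move/matrixP: xz => xz; split=> v vV.
- have := xz (lshift _ (lshift _ (enum_rank_in vV v))) 0.
  by rewrite !col_mxEu !mxE /layout !split_lshift enum_rankK_in.
- have := xz (lshift _ (rshift _ (enum_rank_in vV v))) 0.
  by rewrite !col_mxEu !col_mxEd !mxE /layout split_lshift split_rshift
             enum_rankK_in.
Qed.

(** By [quad_block] the energy of an admissible potential exceeds [geff L Va Vb]
    by a value of the quadratic form of [L_cc].  That form is the energy of
    potentials vanishing on [Va] and [Vb], hence nonnegative, and choosing
    [z = - L_cc^-1 B^T e] on the remaining nodes makes its argument 0. *)
Lemma geff_variational (R : realType) (V : finType) (L : 'M[R]_#|V|)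
    (Va Vb : {set V}) :
  psd L -> constant_kernel L -> Va != set0 -> Va :&: Vb = set0 ->
  (forall x, potential Va Vb x -> geff L Va Vb <= quad L x) /\
  (exists2 x, potential Va Vb x & quad L x = geff L Va Vb).
Proof.
move=> [symL posL] ckL nzVa disj; set f := @layout V Va Vb.
have bij_f : bijective f by apply: layout_bij.
have [g fK gK] := bij_f.
have extend y : rowsub f (rowsub g y) = y :> 'cV[R]_(_).
  by apply/matrixP => i j; rewrite !mxE fK.
pose Vc := ~: (Va :|: Vb).
have blockE := mxsub_layout Va Vb symL.
set M := block_mx (submatrix L Va Va) _ _ _ in blockE.
set B := col_mx _ _ in blockE; set C := submatrix L _ _ in blockE.
have symC : C^T = C by apply/matrixP => i j; rewrite !mxE -[in RHS]symL mxE.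
have unitC : C \in unitmx.
  apply: (@constant_kernel_unitmx R _ _ M B).
    by rewrite addn_gt0 card_gt0 nzVa.
  rewrite -blockE => y; rewrite -(extend y) quad_mxsub // => /ckL cst i j.
  by rewrite [LHS]mxE [RHS]mxE; exact: cst.
pose e := indicator_a R Va Vb.
have geffE : geff L Va Vb = quad (M - B *m invmx C *m B^T) e.
  by rewrite /geff /schur_complement -tr_col_mx.
have energy x z : rowsub f x = col_mx e z ->
    quad L x = geff L Va Vb + quad C (z + invmx C *m B^T *m e).
  by move=> xz; rewrite -(quad_mxsub L x bij_f) blockE xz quad_block // geffE.
have posC z : 0 <= quad C z.
  have -> : quad C z = quad L (rowsub g (col_mx 0 z)); last exact: posL.
  rewrite -(quad_mxsub L _ bij_f) extend blockE /quad tr_col_mx.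
  by rewrite mul_row_block mul_row_col trmx0 !mul0mx mulmx0 !add0r.
split=> [x /potentialP[z /energy ->]|]; first by rewrite lerDl.
pose z := - (invmx C *m B^T *m e).
have xz := extend (col_mx e z).
exists (rowsub g (col_mx e z)); first by apply/potentialP; exists z.
by rewrite (energy _ _ xz) addNr /quad mulmx0 mxE addr0.
Qed.

Lemma quad_potential_gt0 (R : realType) (V : finType) (L : 'M[R]_#|V|)
    (Va Vb : {set V}) (x : 'cV[R]_#|V|) :
  psd L -> constant_kernel L -> Va != set0 -> Vb != set0 ->
  potential Va Vb x -> 0 < quad L x.
Proof.
move=> [_ posL] ckL /set0Pn[a aVa] /set0Pn[b bVb] [xa xb].
rewrite lt_def posL andbT; apply/eqP => /ckL/(_ (enum_rank a) (enum_rank b)).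
by rewrite xa // xb // => /eqP; rewrite oner_eq0.
Qed.

Theorem theorem3 (R : realType) (V : finType) (G : signed_graph R V)
    (o : orientation G) (hG : connected_graph G)
    (hpsd : psd (laplacian o)) (hsimple : simple_eigenvalue (laplacian o) 0)
    (Va Vb Va' Vb' : {set V})
    (hVa : Va != set0) (hVb : Vb != set0)
    (hVa' : Va' != set0) (hVb' : Vb' != set0)
    (hdisj : Va :&: Vb = set0)
    (hsubA : Va' \subset Va) (hsubB : Vb' \subset Vb) :
  ((0 < reff (laplacian o) Va Vb)%E /\
   (reff (laplacian o) Va Vb <= reff (laplacian o) Va' Vb')%E) /\
  (geff (laplacian o) Va Vb >= geff (laplacian o) Va' Vb' /\
   geff (laplacian o) Va' Vb' > 0).
Proof.
have ckL := laplacian_constant_kernel hpsd hsimple.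
have hdisj' : Va' :&: Vb' = set0.
  by apply/eqP; rewrite -subset0 -hdisj setISS.
have [_ [x pot_x gE]] := geff_variational hpsd ckL hVa hdisj.
have [minor' [x' pot_x' gE']] := geff_variational hpsd ckL hVa' hdisj'.
have pot'_x : potential Va' Vb' x.
  case: pot_x => xa xb.
  by split=> v vV; [apply/xa/(subsetP hsubA)|apply/xb/(subsetP hsubB)].
have g'_gt0 : 0 < geff (laplacian o) Va' Vb'.
  by rewrite -gE'; apply: (quad_potential_gt0 hpsd ckL hVa' hVb' pot_x').
have le_g'g : geff (laplacian o) Va' Vb' <= geff (laplacian o) Va Vb.
  by rewrite -gE; apply: minor'.
have g_gt0 := lt_le_trans g'_gt0 le_g'g.
split=> //; rewrite /reff !inver !gt_eqF // lte_fin lee_fin invr_gt0.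
by rewrite lef_pV2.
Qed.
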